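(* Let $G$ be a (finite, not necessarily connected) bipartite graph. Then A wins the gp achievement game on $G$ if and only if the number of isolated vertices in $G$ is odd.
   Context: A general position set of a graph $G$ is a set $S\subseteq V(G)$ such that no three vertices of $S$ lie on a common shortest path of $G$. The gp achievement game on $G$: players A and B alternately select vertices of $G$, A first; a selection of a vertex is legal if it has not been selected before and the set of all vertices selected so far (including it) is a general position set of $G$. The game ends when no legal move exists, and the player who selected the last vertex wins; ''a player wins the game'' means that player has a winning strategy. *)

(* Defs.v *)
From mathcomp Require Import all_boot.

Set Implicit Arguments.
Unset Strict Implicit.
Unset Printing Implicit Defensive.

(* A finite simple graph is a symmetric irreflexive relation [e] on a finType. *)

Definition bipartite (T : finType) (e : rel T) : Prop :=
  exists X : {set T}, forall x y : T, e x y -> (x \in X) != (y \in X).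

Definition isolated (T : finType) (e : rel T) : {set T} :=
  [set x | [forall y, ~~ e x y]].

(* The path x :: p has length [size p] and ends at [last x p]. *)
Definition gpath (T : finType) (e : rel T) (x : T) (p : seq T) : bool :=
  path e x p && uniq (x :: p).

Definition shortest_path (T : finType) (e : rel T) (x : T) (p : seq T) : Prop :=
  gpath e x p /\
  forall q : seq T, gpath e x q -> last x q = last x p -> size p <= size q.

Definition general_position (T : finType) (e : rel T) (S : {set T}) : Prop :=
  forall u v w : T, u \in S -> v \in S -> w \in S -> uniq [:: u; v; w] ->
  ~ exists (x : T) (p : seq T),
      shortest_path e x p /\ [/\ u \in x :: p, v \in x :: p & w \in x :: p].

(* A history lists the selected vertices in chronological order. *)
Definition legal (T : finType) (e : rel T) (h : seq T) (v : T) : Prop :=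
  v \notin h /\ general_position e [set x in rcons h v].

Definition game_over (T : finType) (e : rel T) (h : seq T) : Prop :=
  forall v : T, ~ legal e h v.

Variant player := playerA | playerB.

Definition to_move (T : finType) (h : seq T) : player :=
  if odd (size h) then playerB else playerA.

Definition last_mover (T : finType) (h : seq T) : option player :=
  if h is [::] then None
  else Some (if odd (size h) then playerA else playerB).

(* Histories reachable when player [P] selects according to [s] and the
   opponent makes arbitrary legal moves. *)
Inductive play_with (T : finType) (e : rel T) (P : player) (s : seq T -> T) :
    seq T -> Prop :=
| play_start : play_with e P s [::]
| play_move (h : seq T) (v : T) :
    play_with e P s h -> legal e h v -> (to_move h = P -> v = s h) ->
    play_with e P s (rcons h v).

(* The first clause makes [s] a genuine strategy: it must propose a legal move
   whenever one exists.  Its values on other histories are irrelevant.  Plays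
   have length at most #|T|, so the second clause does not need to exclude
   infinite plays. *)
Definition winning_strategy (T : finType) (e : rel T) (P : player)
    (s : seq T -> T) : Prop :=
  forall h : seq T, play_with e P s h ->
    (to_move h = P -> ~ game_over e h -> legal e h (s h)) /\
    (game_over e h -> last_mover h = Some P).

Definition wins (T : finType) (e : rel T) (P : player) : Prop :=
  exists s : seq T -> T, winning_strategy e P s.

(* Main.v *)
Require Import Defs.
From mathcomp Require Import all_boot.

Set Implicit Arguments.
Unset Strict Implicit.
Unset Printing Implicit Defensive.

(** Adjacent vertices u, v of a bipartite graph are at distances from any third
    vertex z of their component that differ by exactly one, so u, v and z lie on
    a common shortest path.  Hence once both ends of an edge are selected, the
    component of that edge is closed.  The second player therefore answers a
    non-isolated vertex by one of its neighbours and an isolated vertex by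
    another isolated one; this works when the number of isolated vertices is
    even.  When it is odd, A first selects an isolated vertex and then answers
    in the same way. *)

Section GpGame.

Variables (T : finType) (e : rel T).

(** * Shortest walks, parity and isolated vertices *)

Definition shortest_walk (x : T) (p : seq T) : Prop :=
  path e x p /\
  forall q : seq T, path e x q -> last x q = last x p -> size p <= size q.

(** Removing the repetitions from a minimal walk cannot make it shorter, so there were none. *)
Lemma shortest_walk_path (x : T) (p : seq T) :
  shortest_walk x p -> shortest_path e x p.
Proof.
move=> [ep minp]; split; last by move=> q /andP[eq _]; apply: minp.
rewrite /gpath ep /=; move: minp.
have [p' ep' /= /andP[xp' up'] sub_p'] := shortenP ep.
move=> /(_ _ ep' erefl) minp.
have [_ eqp] := uniq_min_size up' sub_p' minp.
by rewrite -eqp xp' (leq_size_uniq up' sub_p' minp).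
Qed.

Lemma shortest_walk_exists (x y : T) :
  connect e x y -> exists2 p, shortest_walk x p & last x p = y.
Proof.
move=> cxy.
pose P n := [exists t : n.-tuple T, path e x t && (last x t == y)].
have exP : exists n, P n.
  have [p ep yp] := connectP cxy; exists (size p).
  by apply/existsP; exists (in_tuple p); rewrite ep yp eqxx.
case: (ex_minnP exP) => n /existsP[t /andP[et /eqP lt]] minn.
exists (val t) => //; split=> // q eq; rewrite lt size_tuple => lq; apply: minn.
by apply/existsP; exists (in_tuple q); rewrite eq /= lq eqxx.
Qed.

Lemma path_parity (X : {set T}) (x : T) (p : seq T) :
  (forall u v, e u v -> (u \in X) != (v \in X)) -> path e x p ->
  (last x p \in X) = odd (size p) (+) (x \in X).
Proof.
move=> bipX; elim: p x => //= y p IH x /andP[exy /IH->].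
by move: (bipX _ _ exy); case: (x \in X); case: (y \in X); case: odd.
Qed.

Lemma isolated_nbr (v w : T) : e v w -> v \notin isolated e.
Proof.
by move=> evw; rewrite inE negb_forall; apply/existsP; exists w; rewrite negbK.
Qed.

Lemma connect_isolated (v w : T) : v \in isolated e -> connect e v w -> v = w.
Proof.
rewrite inE => /forallP iv /connectP[[|y p] //= /andP[evy _] _].
by have := iv y; rewrite evy.
Qed.

(** * General position within components *)

Hypothesis e_sym : symmetric e.

Lemma on_path_connect (x u v : T) (p : seq T) :
  path e x p -> u \in x :: p -> v \in x :: p -> connect e u v.
Proof.
move=> ep up vp; apply: (@connect_trans _ _ x); last exact: path_connect vp.
by rewrite sym_connect_sym //; apply: path_connect up.
Qed.

(** A shortest path through [w] stays in the component of [w], where [S] has at most the vertex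
    [v]. *)
Lemma general_position_setU1 (S : {set T}) (v w : T) :
  general_position e S -> (forall x, x \in S -> connect e w x -> x = v) ->
  general_position e (w |: S).
Proof.
move=> gpS Sv a b c aS bS cS uabc [x [p [sp [ap bp cp]]]].
have /andP[ep _] := sp.1.
have abc_p : {subset [:: a; b; c] <= x :: p}.
  by move=> z; rewrite !in_cons orbF => /or3P[] /eqP->.
have abc_S : {subset [:: a; b; c] <= w |: S}.
  by move=> z; rewrite !in_cons orbF => /or3P[] /eqP->.
have [w_abc|w_abc] := boolP (w \in [:: a; b; c]).
  (* Three distinct vertices would fit into a list of two. *)
  have /(uniq_leq_size uabc) // : {subset [:: a; b; c] <= [:: w; v]}.
  move=> z z_abc; move: (abc_S z z_abc); rewrite !inE => /orP[->//|zS].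
  apply/orP; right; apply/eqP/Sv => //.
  exact: on_path_connect ep (abc_p _ w_abc) (abc_p _ z_abc).
have abc_in z : z \in [:: a; b; c] -> z \in S.
  by move=> z_abc; case/setU1P: (abc_S z z_abc) => // zw; rewrite -zw z_abc in w_abc.
apply: (gpS a b c) => //; try by apply: abc_in; rewrite !inE eqxx ?orbT.
by exists x, p; split.
Qed.

Hypothesis e_bip : bipartite e.

Lemma edge_shortest_path (u v z : T) :
  e u v -> connect e z u ->
  exists x p, shortest_path e x p /\ [/\ u \in x :: p, v \in x :: p & z \in x :: p].
Proof.
have [X bipX] := e_bip; move=> euv czu.
have czv : connect e z v by apply: connect_trans czu (connect1 euv).
have [p sp pu] := shortest_walk_exists czu.
have [q sq qv] := shortest_walk_exists czv.
(* Equal lengths would put [u] and [v] on the same side of the bipartition. *)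
have neq_pq : size p != size q.
  apply/eqP=> eq_pq; move: (bipX _ _ euv).
  rewrite -pu -qv (path_parity bipX sp.1) (path_parity bipX sq.1) eq_pq.
  by rewrite eqxx.
wlog lt_pq : u v p q euv czu czv sp pu sq qv neq_pq / size p < size q => [th|].
  move: (neq_pq); rewrite neq_ltn => /orP[|] lt_pq; first exact: (th u v p q).
  have [||x [r [sr [? ? ?]]]] := th v u q p _ czv czu sq qv sp pu _ lt_pq.
  - by rewrite e_sym.
  - by rewrite eq_sym.
  - by exists x, r.
(* Extending the walk to the nearer end by the edge gives length [(size p).+1], at most [size q],
   hence minimal. *)
exists z, (rcons p v); split.
  apply: shortest_walk_path; split; first by rewrite rcons_path sp.1 pu.
  rewrite last_rcons size_rcons => r er rv.
  by apply: leq_trans lt_pq (sq.2 r er _); rewrite rv.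
rewrite -rcons_cons !mem_rcons !inE !eqxx !orbT; split=> //.
by rewrite -in_cons -pu mem_last orbT.
Qed.

(** * Balanced positions and replies *)

Definition unused_isolated (h : seq T) : {set T} :=
  isolated e :\: [set x in h].

(* The positions that the replying player leaves to the opponent. *)
Definition balanced (h : seq T) : Prop :=
  ~~ odd #|unused_isolated h| /\
  forall x, x \in h -> x \notin isolated e -> exists2 y, y \in h & e x y.

(** Meant for a history [h] that already ends with [v], so that an isolated reply differs from
    [v]. *)
Definition is_reply (h : seq T) (v w : T) : bool :=
  if v \in isolated e then w \in unused_isolated h else e v w.

Lemma mem_rcons2 (h : seq T) (v w x : T) :
  (x \in rcons (rcons h v) w) = [|| x == w, x == v | x \in h].
Proof. by rewrite mem_rcons in_cons mem_rcons. Qed.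

Lemma unused_isolated_rcons (h : seq T) (v : T) :
  unused_isolated (rcons h v) = unused_isolated h :\ v.
Proof.
by apply/setP=> x; rewrite !inE mem_rcons inE negb_or andbA.
Qed.

Lemma in_unused_isolated (h : seq T) (v : T) :
  v \notin h -> (v \in unused_isolated h) = (v \in isolated e).
Proof. by move=> vh; rewrite in_setD inE vh. Qed.

Lemma set_rcons (h : seq T) (v : T) : [set x in rcons h v] = v |: [set x in h].
Proof. by apply/setP=> x; rewrite !inE mem_rcons. Qed.

Lemma legal_isolated (h : seq T) (v : T) :
  general_position e [set x in h] -> v \in unused_isolated h -> legal e h v.
Proof.
rewrite !inE => gph /andP[vh iv]; split=> //; rewrite set_rcons.
by apply: (@general_position_setU1 _ v) => // x _ /connect_isolated-> //; rewrite inE.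
Qed.

Lemma odd_unused_isolated_rcons (h : seq T) (v : T) :
  v \in unused_isolated h ->
  odd #|unused_isolated (rcons h v)| = ~~ odd #|unused_isolated h|.
Proof.
by move=> iv; rewrite (cardsD1 v (unused_isolated h)) iv unused_isolated_rcons
                      oddD addTb negbK.
Qed.

Lemma reply_exists (h : seq T) (v : T) :
  balanced h -> legal e h v -> exists w, is_reply (rcons h v) v w.
Proof.
move=> [ev _] [vh _]; rewrite /is_reply; have [iv|] := boolP (v \in isolated e).
  apply/set0Pn; rewrite -card_gt0 lt0n; apply/eqP=> c0.
  have := @odd_unused_isolated_rcons h v.
  by rewrite in_unused_isolated // c0 ev => /(_ iv).
by rewrite inE negb_forall => /existsP[w]; rewrite negbK; exists w.
Qed.

(** A non-isolated [x] has a selected neighbour [y]; if [v] were in their component, [x], [y] and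
    [v] would lie on a common shortest path. *)
Lemma separated_move (h : seq T) (v x : T) :
  balanced h -> legal e h v -> x \in h -> ~~ connect e v x.
Proof.
move=> [_ nbr] [vh gpv] xh; apply/negP=> cvx.
have xv : x != v by apply: contraNneq vh => <-.
have [ix|nix] := boolP (x \in isolated e).
  case/eqP: xv; apply: connect_isolated ix _.
  by rewrite sym_connect_sym.
have [y yh exy] := nbr x xh nix.
apply: (gpv x y v); rewrite ?inE ?mem_rcons ?inE ?eqxx ?xh ?yh ?orbT //.
  rewrite /= !inE negb_or xv andbT !andbA andbT; apply/andP; split.
    by apply/eqP=> xy; have [X /(_ _ _ exy)] := e_bip; rewrite xy eqxx.
  by apply: contraNneq vh => <-.
exact: edge_shortest_path exy cvx.
Qed.

Lemma reply_balanced (h : seq T) (v w : T) :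
  balanced h -> legal e h v -> is_reply (rcons h v) v w ->
  legal e (rcons h v) w /\ balanced (rcons (rcons h v) w).
Proof.
move=> bh lv; have sep := separated_move bh lv.
case: bh => ev nbr; case: lv => vh gpv.
rewrite /is_reply; have [iv iw|niv evw] := boolP (v \in isolated e).
  split; first exact: legal_isolated.
  split.
    rewrite (odd_unused_isolated_rcons iw) odd_unused_isolated_rcons ?negbK //.
    by rewrite in_unused_isolated.
  move=> x; rewrite mem_rcons2 => /or3P[/eqP->|/eqP->|xh] nix.
  - by case/setDP: iw nix => ->.
  - by rewrite iv in nix.
  - by have [y yh exy] := nbr x xh nix; exists y; rewrite // mem_rcons2 yh !orbT.
have ewv : e w v by rewrite e_sym.
have w_neq_v : w != v.
  by apply/eqP=> wv; have [X /(_ _ _ evw)] := e_bip; rewrite wv eqxx.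
(* The neighbour [w] lies in the component of [v], which [h] does not meet. *)
have wh : w \notin h by apply: contraL (connect1 evw) => /sep.
split.
  split; first by rewrite mem_rcons inE negb_or w_neq_v.
  rewrite set_rcons; apply: (@general_position_setU1 _ v) => // x.
  rewrite set_rcons => /setU1P[//|]; rewrite inE => xh cwx.
  by have := sep x xh; rewrite (connect_trans (connect1 evw) cwx).
split.
  rewrite !unused_isolated_rcons; congr (~~ odd _): ev; apply: eq_card => x.
  rewrite !inE; case: (eqVneq x w) => [->|_] /=.
    by have := isolated_nbr ewv; rewrite inE => /negbTE->; rewrite andbF.
  case: (eqVneq x v) => [->|_] //=.
  by have := isolated_nbr evw; rewrite inE => /negbTE->; rewrite andbF.
move=> x; rewrite mem_rcons2 => /or3P[/eqP->|/eqP->|xh] nix.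
- by exists v; rewrite // mem_rcons2 eqxx orbT.
- by exists w; rewrite // mem_rcons2 eqxx.
- by have [y yh exy] := nbr x xh nix; exists y; rewrite // mem_rcons2 yh !orbT.
Qed.

(** * Outcome of the game *)

Lemma play_uniq (P : player) (s : seq T -> T) (h : seq T) :
  play_with e P s h -> uniq h.
Proof. by elim=> // {}h v _ uh [vh _] _; rewrite rcons_uniq vh. Qed.

(** In the even case, B's replies against a winning strategy of A would produce arbitrarily long
    plays, although no vertex is selected twice. *)
Lemma winsA_odd_isolated : wins e playerA -> odd #|isolated e|.
Proof.
move=> [s winS]; apply/negPn/negP=> ev.
have long n : exists h, [/\ play_with e playerA s h, size h = n.*2 & balanced h].
  elim: n => [|n [h [ph sh bh]]].
    exists [::]; split; first exact: play_start.
    - by [].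
    - by split=> //; rewrite /unused_isolated set_nil setD0.
  have [mv over] := winS h ph.
  have toA : to_move h = playerA by rewrite /to_move sh odd_double.
  have lv : legal e h (s h).
    (* At even length the last mover is B or nobody, so the game cannot be over. *)
    apply: mv => // /over; case: (h) sh => //= a h' sh.
    by rewrite -[~~ odd _]/(odd (size h').+1) sh odd_double.
  have [w rw] := reply_exists bh lv.
  have [lw bw] := reply_balanced bh lv rw.
  exists (rcons (rcons h (s h)) w); split=> //; last by rewrite !size_rcons sh.
  apply: play_move => //; first exact: play_move.
  by rewrite /to_move size_rcons /= sh odd_double.
have [h [ph sh _]] := long #|T|.+1.
have := max_card (mem h); rewrite (card_uniqP (play_uniq ph)) sh -addnn.
by rewrite addSn ltnNge leq_addr.
Qed.

Lemma odd_isolated_winsA : odd #|isolated e| -> wins e playerA.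
Proof.
move=> oddI.
have /card_gt0P[x0 ix0] : 0 < #|isolated e| by case: #|_| oddI.
(* On the empty history [last x0 h] is the isolated [x0], so the same formula opens with an isolated
   vertex. The default [x0] serves only histories without a reply. *)
pose s h := odflt x0 [pick w | is_reply h (last x0 h) w].
have sP h : (exists w, is_reply h (last x0 h) w) -> is_reply h (last x0 h) (s h).
  by rewrite /s; case: pickP => //= no [w]; rewrite no.
have s_nil : s [::] \in isolated e.
  have := sP [::]; rewrite /is_reply /= ix0 => sN.
  suff : s [::] \in unused_isolated [::] by rewrite inE => /andP[].
  by apply: sN; exists x0; rewrite in_unused_isolated.
have to_moveA h : to_move h = playerA -> ~~ odd (size h).
  by rewrite /to_move; case: odd.
pose after_opponent h :=
  h = [::] \/ exists h' v, [/\ h = rcons h' v, balanced h' & legal e h' v].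
have s_good h : after_opponent h -> legal e h (s h) /\ balanced (rcons h (s h)).
  case=> [->|[h' [v [-> bh' lv]]]]; last first.
    apply: reply_balanced => //.
    by have := sP (rcons h' v); rewrite last_rcons; apply; apply: reply_exists.
  have iN : s [::] \in unused_isolated [::] by rewrite in_unused_isolated.
  split.
    by apply: legal_isolated => // a b c; rewrite inE.
  split; last by move=> x; rewrite inE => /eqP->; rewrite s_nil.
  by rewrite odd_unused_isolated_rcons // negbK /unused_isolated set_nil setD0.
exists s.
(* Odd length means that A has just moved. *)
have inv h : play_with e playerA s h ->
    if odd (size h) then balanced h else after_opponent h.
  elim=> [|{}h v _ IH lv sv]; first by left.
  rewrite size_rcons /=; move: IH sv; rewrite /to_move.
  case: odd => /= [bh _|ah ->//]; first by right; exists h, v.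
  exact: (s_good h ah).2.
move=> h /inv; rewrite /to_move; case: (boolP (odd _)) => oh ih; split=> //.
- by move=> _; case: (h) oh => //= a h' ->.
- by move=> _ _; apply: (s_good h ih).1.
(* With A to move a legal reply always exists, so the game can only end after a move of A. *)
- by move=> over; case: (over (s h)); apply: (s_good h ih).1.
Qed.

End GpGame.

Theorem theorem2p5 (T : finType) (e : rel T)
  (e_sym : symmetric e) (e_irr : irreflexive e) (e_bip : bipartite e) :
  wins e playerA <-> odd #|isolated e|.
Proof.
by split; [exact: winsA_odd_isolated | exact: odd_isolated_winsA].
Qed.
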